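(* Let $(\rho_h,\theta_h,\eta_h)\in C^1(0,T;\mathcal V_h\times\mathcal V_h^+\times\mathcal V_h)$, $(\mu_{\rho,h},\mu_{\eta,h})\in C^0(0,T;\mathcal V_h\times\mathcal V_h)$ be a solution of the semi-discrete problem: for all $v_{1,h},v_{2,h},\xi_h,w_{1,h},w_{2,h}\in\mathcal V_h$ and all $0\le t\le T$, \begin{align*} &\langle \partial_t\rho_h,v_{1,h}\rangle+\langle \mathbf L_{11}\nabla\mu_{\rho,h}-\mathbf L_{12}\nabla\theta_h+\mu_{\eta,h}\mathbf L_{13},\nabla v_{1,h}\rangle=0,\\ &\langle \mu_{\rho,h},v_{2,h}\rangle-\gamma_\rho\langle\nabla\rho_h,\nabla v_{2,h}\rangle-\langle\partial_\rho\psi(\rho_h,\theta_h,\eta_h),v_{2,h}\rangle=0,\\ &\langle\partial_t e(\rho_h,\theta_h,\eta_h),\xi_h\rangle+\langle\mathbf L_{12}\nabla\mu_{\rho,h}-\mathbf L_{22}\nabla\theta_h+\mu_{\eta,h}\mathbf L_{23},\nabla\xi_h\rangle=0,\\ &\langle\partial_t\eta_h,w_{1,h}\rangle+\langle\mathbf L_{13}\cdot\nabla\mu_{\rho,h}-\mathbf L_{23}\cdot\nabla\theta_h+\mathbf L_{33}\mu_{\eta,h},w_{1,h}\rangle=0,\\ &\langle\mu_{\eta,h},w_{2,h}\rangle-\gamma_\eta\langle\nabla\eta_h,\nabla w_{2,h}\rangle-\langle\partial_\eta\psi(\rho_h,\theta_h,\eta_h),w_{2,h}\rangle=0, \end{align*}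 with $(\rho_h,\theta_h,\eta_h)(0)=(\rho_{0,h},\theta_{0,h},\eta_{0,h})\in\mathcal V_h\times\mathcal V_h^+\times\mathcal V_h$ given. Then the solution conserves mass and internal energy and produces entropy, i.e. $$\langle\partial_t\rho_h,1\rangle=\langle\partial_t e(\rho_h,\theta_h,\eta_h),1\rangle=0,\qquad \langle\partial_t s(\rho_h,\theta_h,\eta_h),1\rangle=\mathcal D_{\mathbf L}(\mu_{\rho,h},\theta_h,\mu_{\eta,h}).$$
   Context: Domain: $\Omega\subset\mathbb R^d$, $d\in\{2,3\}$, is a cube identified with the $d$-dimensional torus; all functions on $\Omega$ are periodic. $\langle\cdot,\cdot\rangle$ is the $L^2(\Omega)$ inner product. Finite elements: $\mathcal T_h$ is a geometrically conforming partition of $\Omega$ into simplices which can be extended periodically; $\mathcal V_h$ is the space of continuous (periodic) functions that are affine on each $K\in\mathcal T_h$, and $\mathcal V_h^+=\{v\in\mathcal V_h: v(x)>0\ \forall x\in\Omega\}$. Parameters: $\gamma_\rho,\gamma_\eta>0$. Mobility: $\mathbf L_{11},\mathbf L_{12},\mathbf L_{22}$ are $d\times d$-matrix valued, $\mathbf L_{13},\mathbf L_{23}$ are $\mathbb R^d$-valued and $\mathbf L_{33}$ is scalar; all are functions of $(\rho,\nabla\rho,\theta,\eta,\nabla\eta)$, evaluated in the system at $(\rho_h,\nabla\rho_h,\theta_h,\eta_h,\nabla\eta_h)$. The matrix $$\mathbf L=\begin{pmatrix}\mathbf L_{11}&-\mathbf L_{12}&\mathbf L_{13}\\-\mathbf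 L_{12}&\mathbf L_{22}&-\mathbf L_{23}\\ \mathbf L_{13}^\top&-\mathbf L_{23}^\top&\mathbf L_{33}\end{pmatrix}\in\mathbb R^{(2d+1)\times(2d+1)}$$ satisfies $\lambda_0|\xi|^2\le\xi^\top\mathbf L\xi\le\lambda_1|\xi|^2$ for all $\xi\in\mathbb R^{2d+1}$ with constants $\lambda_0,\lambda_1>0$; every component of $\mathbf L$ is $C^1$ in all arguments with first partial derivatives bounded by a constant. Define $$\mathcal D_{\mathbf L}(\mu_\rho,\theta,\mu_\eta)=\int_\Omega (\nabla\mu_\rho,\nabla\theta,\mu_\eta)\,\mathbf L\,(\nabla\mu_\rho,\nabla\theta,\mu_\eta)^\top dx .$$ Potential: $\psi:\mathbb R\times(0,\infty)\times\mathbb R\to\mathbb R$, $(\rho,\theta,\eta)\mapsto\psi(\rho,\theta,\eta)$, is smooth; for every fixed $(\rho,\eta)$, $\psi(\rho,\cdot,\eta)$ is concave with $\psi(\rho,\theta,\eta)\to-\infty$ as $\theta\to0^+$; for every fixed $\theta>0$, $\psi(\cdot,\theta,\cdot)$ is decomposed as $\psi_{vex}+\psi_{cav}$ with $\psi_{vex}$ convex and $\psi_{cav}$ concave in $(\rho,\eta)$. Here $\theta$ is the inverse temperature. Internal energy and entropy densities: $e(\rho,\theta,\eta)=\partial_\theta\psi(\rho,\theta,\eta)$ and $s(\rho,\theta,\eta)=\theta\,\partial_\theta\psi(\rho,\theta,\eta)-\psi(\rho,\theta,\eta)-\frac{\gamma_\rho}2|\nabla\rho|^2-\frac{\gamma_\eta}2|\nabla\eta|^2$.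 *)

(* Defs.v *)
From HB Require Import structures.
From mathcomp Require Import all_boot all_order all_algebra.
From mathcomp Require Import all_classical all_reals all_analysis.

Set Implicit Arguments.
Unset Strict Implicit.
Unset Printing Implicit Defensive.

Import Order.TTheory GRing.Theory Num.Theory.
Import numFieldNormedType.Exports.

Local Open Scope classical_set_scope.
Local Open Scope ring_scope.

(* The norm of ['cV[R]_n] in the library is the maximum norm; [dot u u] is the
   squared Euclidean norm. *)
Definition dot {R : realType} {n : nat} (u v : 'cV[R]_n) : R :=
  (u^T *m v) ord0 ord0.

Section Integration.
Context {R : realType}.

Definition cube {d : nat} (a : 'cV[R]_d) (l : R) : set 'cV[R]_d :=
  [set x | forall i, a i ord0 <= x i ord0 <= a i ord0 + l].

Let leb := @lebesgue_measure R.

(* The library has no Lebesgue measure on ['cV[R]_d]: integrals over the cube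
   are taken in coordinates, against the product Lebesgue measure.  Only d = 2
   and d = 3 are meaningful. *)
Definition pt2 d (z : R * R) : 'cV[R]_d := \col_(i < d) [:: z.1; z.2]`_i.
Definition pt3 d (z : R * R * R) : 'cV[R]_d :=
  \col_(i < d) [:: z.1.1; z.1.2; z.2]`_i.

Definition cube_integral {d : nat} (a : 'cV[R]_d) (l : R) (f : 'cV[R]_d -> R) : R :=
  match d with
  | 2 => \int[(leb \x leb)%E]_(z in [set z | cube a l (pt2 d z)]) f (pt2 d z)
  | 3 => \int[(leb \x leb \x leb)%E]_(z in [set z | cube a l (pt3 d z)])
           f (pt3 d z)
  | _ => 0
  end.

Definition inner {d : nat} (a : 'cV[R]_d) (l : R) (f g : 'cV[R]_d -> R) : R :=
  cube_integral a l (fun x => f x * g x).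

Definition vinner {d : nat} (a : 'cV[R]_d) (l : R)
    (f g : 'cV[R]_d -> 'cV[R]_d) : R :=
  cube_integral a l (fun x => dot (f x) (g x)).

End Integration.

Section FiniteElements.
Context {R : realType} {d : nat}.

(* A simplex is given by the family of its d + 1 vertices.  [face q S] is the
   convex hull of the vertices indexed by [S]; it is empty for [S = set0]. *)
Definition face (q : 'I_d.+1 -> 'cV[R]_d) (S : {set 'I_d.+1}) : set 'cV[R]_d :=
  [set x | exists w : 'I_d.+1 -> R,
     [/\ forall i, 0 <= w i, forall i, i \notin S -> w i = 0,
         \sum_i w i = 1 & x = \sum_i w i *: q i]].

Definition simplex (q : 'I_d.+1 -> 'cV[R]_d) : set 'cV[R]_d := face q [set: _].

Definition affinely_independent (q : 'I_d.+1 -> 'cV[R]_d) : Prop :=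
  forall w : 'I_d.+1 -> R,
    \sum_i w i = 0 -> \sum_i w i *: q i = 0 -> forall i, w i = 0.

Definition meet_in_common_face (q q' : 'I_d.+1 -> 'cV[R]_d) : Prop :=
  exists S S' : {set 'I_d.+1},
    simplex q `&` simplex q' = face q S /\ face q S = face q' S'.

Definition translate (u : 'cV[R]_d) (q : 'I_d.+1 -> 'cV[R]_d) :
  'I_d.+1 -> 'cV[R]_d := fun i => q i + u.

Definition periodic_mesh (a : 'cV[R]_d) (l : R) (J : finType)
    (p : J -> 'I_d.+1 -> 'cV[R]_d) : Prop :=
  [/\ forall j, affinely_independent (p j),
      \bigcup_j simplex (p j) = cube a l,
      forall i j, i != j -> (simplex (p i))° `&` (simplex (p j))° = set0
    & (* [m = 0]: the mesh is conforming; all [m]: so is its l-periodic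
         extension to the whole space *)
      forall (i j : J) (m : 'cV[int]_d),
        meet_in_common_face (p i) (translate (l *: map_mx intr m) (p j))].

Definition affine_on (A : set 'cV[R]_d) (v : 'cV[R]_d -> R) : Prop :=
  exists (b : 'cV[R]_d) (c : R), forall x, A x -> v x = dot b x + c.

Definition periodic (l : R) (v : 'cV[R]_d -> R) : Prop :=
  forall (i : 'I_d) x, v (x + l *: delta_mx i ord0) = v x.

Definition Vh (l : R) (J : finType) (p : J -> 'I_d.+1 -> 'cV[R]_d) :
    set ('cV[R]_d -> R) :=
  [set v | [/\ periodic l v, continuous v
             & forall j, affine_on (simplex (p j)) v]].

Definition Vhpos (a : 'cV[R]_d) (l : R) (J : finType)
    (p : J -> 'I_d.+1 -> 'cV[R]_d) : set ('cV[R]_d -> R) :=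
  [set v | Vh l p v /\ forall x, cube a l x -> 0 < v x].

(* Elementwise gradient: the classical gradient inside the elements; the value
   on the (Lebesgue-null) union of the element boundaries is set to 0. *)
Definition grad (J : finType) (p : J -> 'I_d.+1 -> 'cV[R]_d)
    (v : 'cV[R]_d -> R) (x : 'cV[R]_d) : 'cV[R]_d :=
  if `[< exists j, (simplex (p j))° x >]
  then \col_i 'D_(delta_mx i ord0) v x else 0.

End FiniteElements.

Section Smoothness.
Context {R : realType} {V : normedModType R}.

(* C^k on an open set [U], by iterated directional derivatives. *)
Fixpoint Ck (U : set V) (k : nat) (f : V -> R) : Prop :=
  match k with
  | 0 => {in U, continuous f}
  | k'.+1 => (forall x, U x -> differentiable f x) /\
             (forall v, Ck U k' ('D_v f))
  end.

Definition smooth (U : set V) (f : V -> R) : Prop := forall k, Ck U k f.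

End Smoothness.

Section TimeRegularity.
Context {R : realType}.

(* Derivative relative to [0, T], hence one-sided at 0 and T. *)
Definition dt (T : R) (f : R -> R) (t : R) : R :=
  lim ((s - t)^-1 * (f s - f t) @[s --> within `[0, T] t^']).

(* C^k([0, T]; V) for a space V of functions with the supremum norm. *)
Definition C0_time {X : choiceType} (T : R) (V : set (X -> R)) (u : R -> X -> R) :
    Prop :=
  (forall t, t \in `[0, T] -> V (u t)) /\
  (forall t, t \in `[0, T] ->
     {uniform, u s @[s --> within `[0, T] (nbhs t)] --> u t}).

Definition C1_time {X : choiceType} (T : R) (V : set (X -> R)) (u : R -> X -> R) :
    Prop :=
  C0_time T V u /\
  exists2 u', C0_time T V u' &
    forall t, t \in `[0, T] ->
      {uniform, (fun x => (s - t)^-1 * (u s x - u t x))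
                  @[s --> within `[0, T] t^'] --> u' t}.

End TimeRegularity.

(* The arguments (rho, grad rho, theta, eta, grad eta) of the mobility. *)
Notation state R d := (R^o * 'cV[R]_d * R^o * R^o * 'cV[R]_d)%type.

Section Mobility.
Context {R : realType} {d : nat}.

Definition admissible : set (state R d) := [set z | 0 < z.1.1.2].

Definition coordinate_direction (z : state R d) : Prop :=
  z = (1, 0, 0, 0, 0) \/ (exists i, z = (0, delta_mx i ord0, 0, 0, 0)) \/
  z = (0, 0, 1, 0, 0) \/ z = (0, 0, 0, 1, 0) \/
  (exists i, z = (0, 0, 0, 0, delta_mx i ord0)).

Record mobility := Mobility {
  L11 : state R d -> 'M[R]_d;
  L12 : state R d -> 'M[R]_d;
  L22 : state R d -> 'M[R]_d;
  L13 : state R d -> 'cV[R]_d;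
  L23 : state R d -> 'cV[R]_d;
  L33 : state R d -> R }.

Definition mobility_matrix (L : mobility) (z : state R d) : 'M[R]_(d + d + 1) :=
  block_mx (block_mx (L11 L z) (- L12 L z) (- L12 L z) (L22 L z))
           (col_mx (L13 L z) (- L23 L z))
           (row_mx (L13 L z)^T (- (L23 L z)^T))
           (L33 L z)%:M.

Definition mobility_elliptic (L : mobility) (lam0 lam1 : R) : Prop :=
  forall z, admissible z -> forall xi : 'cV[R]_(d + d + 1),
    lam0 * dot xi xi <= dot xi (mobility_matrix L z *m xi) <= lam1 * dot xi xi.

Definition mobility_C1_bounded (L : mobility) : Prop :=
  exists M : R, forall i j,
    Ck admissible 1 (fun z => mobility_matrix L z i j) /\
    forall e z, coordinate_direction e -> admissible z ->
      `|'D_e (fun z => mobility_matrix L z i j) z| <= M.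

End Mobility.
Arguments mobility : clear implicits.

Section Potential.
Context {R : realType}.
Implicit Types psi : R -> R -> R -> R.

(* [psi] and the convex and concave parts take their arguments in the order
   (rho, theta, eta); only theta > 0 is meaningful. *)
Definition psi_smooth psi : Prop :=
  smooth [set z : R^o * R^o * R^o | 0 < z.1.2]
         (fun z => psi z.1.1 z.1.2 z.2).

Definition psi_temperature psi : Prop :=
  forall rho eta : R,
    convex_function (E := R^o) [set theta | 0 < theta]
      (fun theta => - psi rho theta eta) /\
    psi rho theta eta @[theta --> 0^'+] --> -oo.

Definition psi_splitting psi psi_vex psi_cav : Prop :=
  forall theta : R, 0 < theta ->
    [/\ forall rho eta,
          psi rho theta eta = psi_vex rho theta eta + psi_cav rho theta eta,
        convex_function (E := (R^o * R^o)%type) setT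
          (fun z => psi_vex z.1 theta z.2)
      & convex_function (E := (R^o * R^o)%type) setT
          (fun z => - psi_cav z.1 theta z.2)].

Definition psi_rho psi (rho theta eta : R) : R :=
  derive1 (fun r => psi r theta eta) rho.
Definition psi_eta psi (rho theta eta : R) : R := derive1 (psi rho theta) eta.

Definition energy psi (rho theta eta : R) : R :=
  derive1 (fun th => psi rho th eta) theta.

End Potential.

Section Fields.
Context {R : realType} {d : nat} {J : finType}.
Variable p : J -> 'I_d.+1 -> 'cV[R]_d.
Implicit Types rho theta eta mu_rho mu_eta : 'cV[R]_d -> R.

Definition fields_state rho theta eta (x : 'cV[R]_d) : state R d :=
  (rho x, grad p rho x, theta x, eta x, grad p eta x).

Definition entropy (psi : R -> R -> R -> R) (gamma_rho gamma_eta : R)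
    rho theta eta (x : 'cV[R]_d) : R :=
  theta x * energy psi (rho x) (theta x) (eta x)
  - psi (rho x) (theta x) (eta x)
  - gamma_rho / 2 * dot (grad p rho x) (grad p rho x)
  - gamma_eta / 2 * dot (grad p eta x) (grad p eta x).

Definition dissipation (a : 'cV[R]_d) (l : R) (Lz : 'cV[R]_d -> 'M[R]_(d + d + 1))
    mu_rho theta mu_eta : R :=
  let F x := col_mx (col_mx (grad p mu_rho x) (grad p theta x))
                    (mu_eta x)%:M in
  cube_integral a l (fun x => dot (F x) (Lz x *m F x)).

End Fields.

Section SemiDiscrete.
Context {R : realType} {d : nat} {J : finType}.
Variables (a : 'cV[R]_d) (l : R) (p : J -> 'I_d.+1 -> 'cV[R]_d).
Variables (gamma_rho gamma_eta : R) (L : mobility R d).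
Variables (psi : R -> R -> R -> R) (T : R).
Variables rho theta eta mu_rho mu_eta : R -> 'cV[R]_d -> R.

Definition semidiscrete_at (t : R) : Prop :=
  let z := fields_state p (rho t) (theta t) (eta t) in
  let Dmu := grad p (mu_rho t) in
  let Dtheta := grad p (theta t) in
  forall v1 v2 xi w1 w2,
    Vh l p v1 -> Vh l p v2 -> Vh l p xi -> Vh l p w1 -> Vh l p w2 ->
  [/\ inner a l (fun x => dt T (rho ^~ x) t) v1
      + vinner a l (fun x => L11 L (z x) *m Dmu x - L12 L (z x) *m Dtheta x
                             + mu_eta t x *: L13 L (z x)) (grad p v1) = 0,
      inner a l (mu_rho t) v2
      - gamma_rho * vinner a l (grad p (rho t)) (grad p v2)
      - inner a l (fun x => psi_rho psi (rho t x) (theta t x) (eta t x)) v2 = 0,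
      inner a l
        (fun x => dt T (fun s => energy psi (rho s x) (theta s x) (eta s x)) t) xi
      + vinner a l (fun x => L12 L (z x) *m Dmu x - L22 L (z x) *m Dtheta x
                             + mu_eta t x *: L23 L (z x)) (grad p xi) = 0,
      inner a l (fun x => dt T (eta ^~ x) t) w1
      + inner a l (fun x => dot (L13 L (z x)) (Dmu x) - dot (L23 L (z x)) (Dtheta x)
                            + L33 L (z x) * mu_eta t x) w1 = 0
    & inner a l (mu_eta t) w2
      - gamma_eta * vinner a l (grad p (eta t)) (grad p w2)
      - inner a l (fun x => psi_eta psi (rho t x) (theta t x) (eta t x)) w2 = 0].

End SemiDiscrete.

(* Main.v *)
Require Import Defs.
From mathcomp Require Import all_boot all_order all_algebra.
From mathcomp Require Import all_classical all_reals all_analysis.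
From mathcomp Require Import measurable_realfun.
From mathcomp Require Import ring lra.

(** Test the first equation with mu_rho, the second with d_t rho, the third with
    theta, the fourth with mu_eta and the fifth with d_t eta.  By the chain rule
      d_t s = theta d_t e - psi_rho d_t rho - psi_eta d_t eta
              - gamma_rho grad rho . grad d_t rho - gamma_eta grad eta . grad d_t eta,
    whose integral the five tested equations turn into the three flux terms
    that make up the dissipation; testing with 1 gives the two conservation laws.

    All identities hold at every point of the cube, including the union of the
    element boundaries: there [grad] is 0 at all times, so that it commutes with
    d_t trivially.  No null set has to be discarded.  The splitting of the integrals
    is legitimate because every integrand is bounded and Borel, being continuous
    on each of the finitely many open simplices and on their complement. *)

Set Implicit Arguments.
Unset Strict Implicit.
Unset Printing Implicit Defensive.

Import Order.TTheory GRing.Theory Num.Theory.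
Import numFieldNormedType.Exports.

Local Open Scope classical_set_scope.
Local Open Scope ring_scope.

(** * Borel sets of vectors and the integral over the cube in coordinates *)

Definition borel (R : realType) d := g_sigma_algebraType (@open 'cV[R]_d).

Lemma open_borel (R : realType) d (U : set 'cV[R]_d) :
  open U -> measurable (U : set (borel R d)).
Proof. exact: sub_sigma_algebra. Qed.

(* Balls of the maximum norm with rational centres form a countable base. *)
Lemma measurable_fun_coordinates (R : realType) d disp (T : measurableType disp)
    (f : T -> 'cV[R]_d) :
  (forall i, measurable_fun setT (fun z => f z i ord0)) ->
  measurable_fun setT (f : T -> borel R d).
Proof.
move=> mf; apply: (@measurability _ _ T (borel R d) setT f open) => //.
move=> _ [U oU <-]; rewrite setTI.
pose B (k : 'cV[rat]_d * nat) : set 'cV[R]_d :=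
  ball (map_mx ratr k.1 : 'cV[R]_d) k.2.+1%:R^-1.
have -> : f @^-1` U = \bigcup_k (if `[< B k `<=` U >] then f @^-1` B k else set0).
  apply/seteqP; split => [z /= Ufz|z [k _]]; last by case: asboolP => // BU /BU.
  move: (oU); rewrite openE => /(_ _ Ufz) /nbhs_ballP[e /= e0 eU].
  have [n /= ne] : exists n : nat, n.+1%:R^-1 < e / 2.
    have := near_infty_natSinv_lt (PosNum (divr_gt0 e0 (@ltr0n R 2))).
    by case=> n _ /(_ n (leqnn n)) /= h; exists n.
  have /choice[q hq] : forall i, exists q : rat, `|f z i ord0 - ratr q| < n.+1%:R^-1.
    move=> i; have [|y [/= yB [q _ qy]]] :=
      @dense_rat R (ball (f z i ord0) n.+1%:R^-1) _ (ball_open _ _).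
      by exists (f z i ord0); apply: ballxx; rewrite invr_gt0.
    by exists q; rewrite qy.
  have Bf : B (\col_i q i, n) (f z).
    split => [|i j]; first by rewrite invr_gt0.
    by rewrite ord1 !mxE -ball_normE /= distrC; exact: hq.
  exists (\col_i q i, n) => //; case: asboolP => // -[y yB]; apply: eU.
  (* The rational centre lies within one radius of [f z], so the ball stays within two radii of it;
     [n] was chosen so that two radii fit into [e]. *)
  apply: (@le_ball _ _ _ (n.+1%:R^-1 + n.+1%:R^-1)).
    by rewrite [leRHS]splitr lerD// ltW.
  exact: ball_triangle (ball_sym Bf) yB.
apply: countable_bigcupT_measurable => [|k]; first exact: countableP.
case: asboolP => // _.
have -> : f @^-1` B k =
    \bigcap_i ((fun z => f z i ord0) @^-1` ball (ratr (k.1 i ord0) : R) k.2.+1%:R^-1).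
  apply/seteqP; split => [z [_ h] i _|z h].
    by have := h i ord0; rewrite mxE.
  split => [|i j]; first by rewrite invr_gt0.
  by rewrite ord1 mxE; apply: h.
apply: fin_bigcap_measurable => // i _; rewrite -[X in measurable X]setTI.
by apply: mf => //; apply: open_measurable; apply: ball_open; rewrite invr_gt0.
Qed.

Lemma borel_cube (R : realType) d (a : 'cV[R]_d) l :
  measurable (cube a l : set (borel R d)).
Proof.
have -> : cube a l = \bigcap_i [set x : 'cV[R]_d |
    (x i ord0 \in `[a i ord0, a i ord0 + l]%R)].
  apply/seteqP; split => x /= h i; first by move=> _; rewrite /= in_itv; exact: h.
  by have := h i I; rewrite /= in_itv.
apply: fin_bigcap_measurable => // i _; rewrite -[X in measurable X]setCK.
apply: measurableC; apply: open_borel; rewrite openC.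
have := @interval_closed R (BLeft (a i ord0)) (BRight (a i ord0 + l)) isT isT.
move/(closed_comp (f := fun x : 'cV[R]_d => x i ord0)); apply => x _.
exact: coord_continuous.
Qed.

(** Compactness of a product of segments is taken for row vectors and carried over by transposition,
    which preserves the maximum norm. *)
Lemma compact_cube (R : realType) d (a : 'cV[R]_d) l : compact (cube a l).
Proof.
have /= := @rV_compact R d (fun i => `[a i ord0, a i ord0 + l]%classic)
  (fun i => @segment_compact _ _ _).
move/(continuous_compact (f := trmx)) => h.
suff -> : cube a l = trmx @` [set v : 'rV[R]_d |
    forall i, `[a i ord0, a i ord0 + l]%classic (v ord0 i)].
  apply: h; apply: continuous_subspaceT => x.
  move=> A /nbhs_ballP[e e0 eA]; apply/nbhs_ballP; exists e => // y [_ xy]; apply: eA.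
  by split => // i j; rewrite !mxE.
apply/seteqP; split => [x h'|_ [x h' <-] i].
  exists x^T; rewrite ?trmxK// => i /=; rewrite in_itv/= mxE; exact: h'.
by rewrite mxE; have := h' i; rewrite /= in_itv.
Qed.

(** This hides the case split on [d]. Later integration arguments see only a measure [mu], a
    measurable map [pt], and a preimage of the cube of finite measure. *)
Lemma cube_integral_coordinates (R : realType) d (a : 'cV[R]_d) l :
  d = 2%N \/ d = 3%N ->
  exists disp (T : measurableType disp) (mu : {measure set T -> \bar R})
      (pt : T -> 'cV[R]_d),
  [/\ measurable_fun setT (pt : T -> borel R d),
      (mu (pt @^-1` cube a l) < +oo)%E
    & forall f, cube_integral a l f = \int[mu]_(z in pt @^-1` cube a l) f (pt z)].
Proof.
pose I (x : R) : set (measurableTypeR R) := `[x, x + l]%classic.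
have mI x : measurable (I x) by exact: measurable_itv.
have finI x : (lebesgue_measure (I x) < +oo)%E.
  by apply: compact_finite_measure; exact: segment_compact.
case=> d_eq; subst d.
- exists _, _, (lebesgue_measure \x lebesgue_measure)%E, (@pt2 R 2); split => //.
    apply: measurable_fun_coordinates => i; under eq_fun do rewrite mxE.
    by case: i => -[|[|]]//= _; [exact: measurable_fst|exact: measurable_snd].
  (* The preimage is a rectangle, so its product measure is a product of finite measures of
     segments. *)
  have -> : pt2 2 @^-1` cube a l = I (a ord0 ord0) `*` I (a ord_max ord0).
    apply/seteqP; split => [z /= h|z /= [+ + i]].
      by split; rewrite /I /= in_itv /=;
         [have := h ord0|have := h ord_max]; rewrite mxE.
    rewrite /I /= !in_itv /= => h0 h1.
    by case: i => -[|[|]]//= i2; rewrite mxE /=;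
      [move: h0; congr (a _ _ <= _ <= a _ _ + _)
      |move: h1; congr (a _ _ <= _ <= a _ _ + _)];
      apply: val_inj.
  rewrite [X in (X < _)%E](_ : _ = lebesgue_measure (I (a ord0 ord0)) *
    lebesgue_measure (I (a ord_max ord0)))%E; last exact: product_measure1E.
  by rewrite lte_mul_pinfty// ge0_fin_numE.
- exists _, _, (lebesgue_measure \x lebesgue_measure \x lebesgue_measure)%E, (@pt3 R 3).
  split => //.
    apply: measurable_fun_coordinates => i; under eq_fun do rewrite mxE.
    case: i => -[|[|[|]]]//= _.
    + exact: measurableT_comp measurable_fst measurable_fst.
    + exact: measurableT_comp measurable_snd measurable_fst.
    + exact: measurable_snd.
  pose i1 : 'I_3 := Ordinal (isT : (1 < 3)%N).
  have -> : pt3 3 @^-1` cube a l =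
      (I (a ord0 ord0) `*` I (a i1 ord0)) `*` I (a ord_max ord0).
    apply/seteqP; split => [z /= h|z /= [[+ +] + i]].
      by split; [split|]; rewrite /I /= in_itv /=;
         [have := h ord0|have := h i1|have := h ord_max]; rewrite mxE.
    rewrite /I /= !in_itv /= => h0 h1 h2.
    by case: i => -[|[|[|]]]//= i3; rewrite mxE /=;
      [move: h0|move: h1|move: h2]; congr (a _ _ <= _ <= a _ _ + _);
      apply: val_inj.
  rewrite [X in (X < _)%E](_ : _ = lebesgue_measure (I (a ord0 ord0)) *
    lebesgue_measure (I (a i1 ord0)) * lebesgue_measure (I (a ord_max ord0)))%E.
    rewrite lte_mul_pinfty// ?mule_ge0// ge0_fin_numE ?mule_ge0//.
    by rewrite lte_mul_pinfty// ge0_fin_numE.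
  rewrite -product_measure1E//; apply: product_measure1E => //; exact: measurableX.
Qed.

(** * Bounded Borel functions on the cube and linearity of the integral *)

Section Tame.
Context {R : realType} {d : nat}.
Variables (a : 'cV[R]_d) (l : R).
Implicit Types f g : 'cV[R]_d -> R.

(** A convenient sufficient condition for integrability, since the cube has finite measure. Unlike
    integrability it is stable under products, and all integrands here are built from sums and
    products. *)
Definition tame f :=
  measurable_fun (cube a l : set (borel R d)) (f : borel R d -> R) /\
  exists M, forall x, cube a l x -> `|f x| <= M.

Lemma tame_cst (c : R) : tame (fun=> c).
Proof. by split; [exact: measurable_cst|exists `|c|]. Qed.

Lemma tameD f g : tame f -> tame g -> tame (fun x => f x + g x).
Proof.
move=> [mf [M fM]] [mg [N gN]]; split; first exact: measurable_funD.
by exists (M + N) => x xa; rewrite (le_trans (ler_normD _ _))// lerD ?fM ?gN.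
Qed.

Lemma tameM f g : tame f -> tame g -> tame (fun x => f x * g x).
Proof.
move=> [mf [M fM]] [mg [N gN]]; split; first exact: measurable_funM.
by exists (M * N) => x xa; rewrite normrM ler_pM ?fM ?gN.
Qed.

Lemma tameN f : tame f -> tame (fun x => - f x).
Proof.
move=> tf; have := tameM (tame_cst (-1)) tf.
by congr tame; apply/funext => x; rewrite mulN1r.
Qed.

Lemma tameB f g : tame f -> tame g -> tame (fun x => f x - g x).
Proof. by move=> tf tg; exact: tameD tf (tameN tg). Qed.

Lemma tame_sum (I : Type) (s : seq I) (P : pred I) (F : I -> 'cV[R]_d -> R) :
  (forall i, tame (F i)) -> tame (fun x => \sum_(i <- s | P i) F i x).
Proof.
move=> tF; elim: s => [|i s IHs].
  by under eq_fun do rewrite big_nil; exact: tame_cst.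
under eq_fun do rewrite big_cons.
by case: (P i) => //; exact: tameD.
Qed.

Lemma tame_eq f g : (forall x, cube a l x -> f x = g x) -> tame f -> tame g.
Proof.
move=> fg [mf [M fM]]; split; last by exists M => x xa; rewrite -fg// fM.
by apply: eq_measurable_fun mf => x; rewrite inE => /fg.
Qed.

(** Boundedness comes from compactness of the cube. Continuity is asked only at points of the cube
    because compositions with the potential are controlled only where [theta] is positive. *)
Lemma tame_continuous f :
  (forall x, cube a l x -> {for x, continuous f}) -> tame f.
Proof.
move=> cf; have {}cf : {in cube a l, continuous f} by move=> x /set_mem /cf.
split.
  apply: (measurability _ (RGenOInfty.measurableE R)) => _ [_ [r ->] <-].
  (* The preimage of an open ray need not be open, but continuity at points of the cube puts each of
     its points there in its interior, so an open set has the same trace on the cube. *)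
  have -> : cube a l `&` f @^-1` `]r, +oo[%classic =
      cube a l `&` (f @^-1` `]r, +oo[%classic)°.
    apply/seteqP; split => x [xa fx]; split => //; last exact: interior_subset fx.
    apply: cf; first by rewrite inE.
    exact: open_nbhs_nbhs.
  apply: measurableI; first exact: borel_cube.
  by apply: open_borel; exact: open_interior.
have /compact_bounded[M [_ fM]] :=
  continuous_compact (continuous_in_subspaceT cf) (@compact_cube R d a l).
by exists (M + 1) => x xa; apply: (fM (M + 1)); [rewrite ltrDl|exists x].
Qed.

(** Gluing over a finite Borel cover: preimages are finite unions of Borel sets, and the sum of the
    local bounds is a global one. Each [g i] is tame on the whole cube, not merely on its piece. *)
Lemma tame_pieces (I : finType) (B : I -> set 'cV[R]_d) (g : I -> 'cV[R]_d -> R) f :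
  (forall i, measurable (B i : set (borel R d))) ->
  (forall x, cube a l x -> exists i, B i x) ->
  (forall i, tame (g i)) ->
  (forall i x, cube a l x -> B i x -> f x = g i x) -> tame f.
Proof.
move=> mB coverB tg fg.
have cubeE : cube a l = \bigcup_i (cube a l `&` B i).
  by apply/seteqP; split => [x xa|x [i _ []]//]; have [i Bi] := coverB x xa; exists i.
have mcB i : measurable (cube a l `&` B i : set (borel R d)).
  by apply: measurableI => //; exact: borel_cube.
split.
  move=> _ Y mY; rewrite cubeE setI_bigcupl; apply: fin_bigcup_measurable => // i _.
  have -> : cube a l `&` B i `&` f @^-1` Y = (cube a l `&` g i @^-1` Y) `&` B i.
    apply/seteqP; split => x /=.
      by move=> [[xa Bx]]; rewrite (fg i).
    by move=> [[xa gx] Bx]; rewrite (fg i).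
  apply: measurableI => //; exact: (tg i).1 (@borel_cube R d a l) _ mY.
have /choice[M gM] i := (tg i).2; exists (\sum_i `|M i|) => x xa.
have [i Bi] := coverB x xa; rewrite (fg i)// (le_trans (gM i x xa))//.
by rewrite (le_trans (ler_norm _))// (bigD1 i)//= lerDl sumr_ge0.
Qed.

Hypothesis d23 : d = 2%N \/ d = 3%N.

Lemma eq_cube_integral f g : (forall x, cube a l x -> f x = g x) ->
  cube_integral a l f = cube_integral a l g.
Proof.
move=> fg; have [disp [T [mu [pt [mpt _ intE]]]]] := cube_integral_coordinates a l d23.
by rewrite !intE; apply: eq_Rintegral => z; rewrite inE => /fg.
Qed.

Lemma tame_integrable f disp (T : measurableType disp)
    (mu : {measure set T -> \bar R}) (pt : T -> 'cV[R]_d) :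
  measurable_fun setT (pt : T -> borel R d) ->
  (mu (pt @^-1` cube a l) < +oo)%E -> tame f ->
  measurable (pt @^-1` cube a l) /\
  mu.-integrable (pt @^-1` cube a l) (EFin \o (f \o pt)).
Proof.
move=> mpt fin [mf [M fM]]; have mD : measurable (pt @^-1` cube a l).
  by rewrite -[X in measurable X]setTI; apply: mpt => //; exact: borel_cube.
split => //; apply: measurable_bounded_integrable => //.
  apply: (measurable_comp (@borel_cube R d a l) _ mf) => [_ [z h <-]//|].
  exact: measurable_funTS.
by exists M; split; [exact: num_real|move=> N MN z /fM /le_trans; apply; exact: ltW].
Qed.

Lemma cube_integralD f g : tame f -> tame g ->
  cube_integral a l (fun x => f x + g x) = cube_integral a l f + cube_integral a l g.
Proof.
move=> tf tg.
have [disp [T [mu [pt [mpt fin intE]]]]] := cube_integral_coordinates a l d23.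
have [mD If] := tame_integrable mpt fin tf; have [_ Ig] := tame_integrable mpt fin tg.
by rewrite !intE (RintegralD mD If Ig).
Qed.

Lemma cube_integralZ c f : tame f ->
  cube_integral a l (fun x => c * f x) = c * cube_integral a l f.
Proof.
move=> tf; have [disp [T [mu [pt [mpt fin intE]]]]] := cube_integral_coordinates a l d23.
by have [mD If] := tame_integrable mpt fin tf; rewrite !intE (RintegralZl c mD If).
Qed.

Lemma cube_integralB f g : tame f -> tame g ->
  cube_integral a l (fun x => f x - g x) = cube_integral a l f - cube_integral a l g.
Proof.
move=> tf tg.
have [disp [T [mu [pt [mpt fin intE]]]]] := cube_integral_coordinates a l d23.
have [mD If] := tame_integrable mpt fin tf; have [_ Ig] := tame_integrable mpt fin tg.
by rewrite !intE (RintegralB mD If Ig).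
Qed.

End Tame.

(** * Time derivatives relative to the interval from 0 to [T] *)

Section TimeDerivative.
Context {R : realType}.
Variable T : R.

(** A relation, because the limit defining [dt] is meaningful only when it exists. Values in a
    normed module allow the triple of unknowns to be differentiated as a single curve. *)
Definition has_dt {V : normedModType R} (f : R -> V) (t : R) (df : V) : Prop :=
  (s - t)^-1 *: (f s - f t) @[s --> within `[0, T] t^'] --> df.

(** Differentiability gives continuity: the increment is [s - t], which tends to 0, times the
    convergent quotient. *)
Lemma has_dt_cvg {V : normedModType R} (f : R -> V) t df :
  has_dt f t df -> f s - f t @[s --> within `[0, T] t^'] --> (0 : V).
Proof.
move=> fdf; have -> : (0 : V) = (0 : R) *: df by rewrite scale0r.
have : (s - t) *: ((s - t)^-1 *: (f s - f t)) @[s --> within `[0, T] t^'] --> 0 *: df.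
  apply: cvgZ fdf; rewrite -[X in _ --> X](subrr t); apply: cvgB; last exact: cvg_cst.
  by apply: cvg_trans (@nbhs_dnbhs _ t); exact: cvg_within.
apply: cvg_trans; apply: near_eq_cvg; rewrite /within /= near_withinE.
near=> s => _; rewrite scalerA divff ?scale1r// subr_eq0.
by near: s; exact: nbhs_dnbhs_neq.
Unshelve. all: by end_near. Qed.

Lemma eq_has_dt {V : normedModType R} (f g : R -> V) t df : t \in `[0, T] ->
  (forall s, s \in `[0, T] -> f s = g s) -> has_dt f t df -> has_dt g t df.
Proof.
move=> t0T fg; apply: cvg_trans; apply: near_eq_cvg.
rewrite /within /= near_withinE; near=> s => sT.
by rewrite (fg t)// (fg s).
Unshelve. all: by end_near. Qed.

Lemma has_dt_cst {V : normedModType R} (c : V) t : has_dt (fun=> c) t 0.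
Proof.
rewrite /has_dt; under eq_fun do rewrite subrr scaler0; exact: cvg_cst.
Qed.

Lemma has_dtD {V : normedModType R} (f g : R -> V) t df dg :
  has_dt f t df -> has_dt g t dg -> has_dt (fun s => f s + g s) t (df + dg).
Proof.
move=> fdf gdg; rewrite /has_dt.
under eq_fun do rewrite opprD addrACA scalerDr; exact: cvgD.
Qed.

Lemma has_dt_sum {V : normedModType R} (I : Type) (r : seq I) (F : I -> R -> V)
    (dF : I -> V) t : (forall i, has_dt (F i) t (dF i)) ->
  has_dt (fun s => \sum_(i <- r) F i s) t (\sum_(i <- r) dF i).
Proof.
move=> FdF; elim: r => [|i r IHr].
  by rewrite big_nil; under eq_fun do rewrite big_nil; exact: has_dt_cst.
by rewrite big_cons; under eq_fun do rewrite big_cons; exact: has_dtD.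
Qed.

Lemma has_dtZ {V : normedModType R} (c : R) (f : R -> V) t df :
  has_dt f t df -> has_dt (fun s => c *: f s) t (c *: df).
Proof.
move=> fdf; rewrite /has_dt.
under eq_fun do rewrite -scalerBr scalerA mulrC -scalerA; exact: cvgZl_tmp.
Qed.

Lemma has_dtB {V : normedModType R} (f g : R -> V) t df dg :
  has_dt f t df -> has_dt g t dg -> has_dt (fun s => f s - g s) t (df - dg).
Proof.
move=> fdf /(has_dtZ (c := -1)); rewrite scaleN1r; under eq_fun do rewrite scaleN1r.
exact: has_dtD.
Qed.

Lemma has_dt_pair {V W : normedModType R} (f : R -> V) (g : R -> W) t df dg :
  has_dt f t df -> has_dt g t dg -> has_dt (fun s => (f s, g s)) t (df, dg).
Proof. exact: cvg_pair. Qed.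

(** Chain rule by splitting the quotient into ['d F (z t) (q s)], which converges since the
    differential is continuous, and a remainder [r s], which vanishes because the Taylor error is
    small relative to [z s - z t] while [q] stays bounded. *)
Lemma has_dt_comp {V : normedModType R} (F : V -> R^o) (z : R -> V) t dz :
  differentiable F (z t) -> has_dt z t dz ->
  has_dt (F \o z) t ('D_dz F (z t)).
Proof.
move=> dF zdz; rewrite deriveE//.
pose q s := (s - t)^-1 *: (z s - z t).
pose r s := (s - t)^-1 *: (F (z s) - F (z t) - 'd F (z t) (z s - z t)).
have qr s : (s - t)^-1 *: ((F \o z) s - (F \o z) t) = 'd F (z t) (q s) + r s.
  by rewrite /q /r linearZ -scalerDr; congr (_ *: _); rewrite [RHS]addrC subrK.
rewrite /has_dt; under eq_fun do rewrite qr.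
rewrite -['d _ _ dz]addr0; apply: cvgD.
  by apply: continuous_cvg zdz; exact: diff_continuous.
apply/cvgr0Pnorm_le => e e0.
(* The tolerance is divided by [|dz| + 1], an eventual bound of the quotients [q s], so that the
   remainder ends up below [e]. *)
have /diff_locallyP[_ /eqaddoP/(_ (e / (`|dz| + 1)))] := dF.
rewrite divr_gt0// ?ltr_wpDl// => /(_ isT) smallF.
have small : \forall s \near within `[0, T] t^',
    `|F (z s) - F (z t) - 'd F (z t) (z s - z t)| <= e / (`|dz| + 1) * `|z s - z t|.
  have := has_dt_cvg zdz smallF; rewrite nbhs_simpl /=; apply: filterS => s /=.
  by rewrite -[X in `|X|]/(F (z s - z t + z t) - (F (z t) + _)) subrK opprD addrA.
have qb : \forall s \near within `[0, T] t^', `|q s| <= `|dz| + 1.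
  by apply: (cvgr_norm_le _ zdz); rewrite ltrDl.
near=> s.
have h : `|F (z s) - F (z t) - 'd F (z t) (z s - z t)| <= e / (`|dz| + 1) * `|z s - z t|.
  by near: s.
rewrite /r normrZ; apply: (le_trans (ler_wpM2l _ h)) => //.
rewrite mulrCA -normrZ -/(q s).
have : `|q s| <= `|dz| + 1 by near: s.
have dz1 : 0 < `|dz| + 1 by rewrite ltr_wpDl.
by rewrite -ler_pdivlMl ?divr_gt0// invf_div -mulrA mulVf ?mulr1// gt_eqF.
Unshelve. all: by end_near. Qed.

Lemma has_dtM (f g : R -> R^o) t (df dg : R^o) :
  has_dt f t df -> has_dt g t dg ->
  has_dt (fun s => f s * g s : R^o) t (df * g t + f t * dg).
Proof.
move=> fdf gdg; rewrite /has_dt.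
have E s : (s - t)^-1 *: (f s * g s - f t * g t : R^o) =
    ((s - t)^-1 *: (f s - f t)) * g t + f t * ((s - t)^-1 *: (g s - g t))
    + ((s - t)^-1 *: (f s - f t)) * (g s - g t).
  by rewrite /GRing.scale /=; ring.
under eq_fun do rewrite E.
have -> : df * g t + f t * dg = df * g t + f t * dg + df * 0 by rewrite mulr0 addr0.
apply: cvgD; last exact: cvgM fdf (has_dt_cvg gdg).
by apply: cvgD; apply: cvgM => //; exact: cvg_cst.
Qed.

Hypothesis T_gt0 : 0 < T.

(** Since [0 < T], every time of the interval is an accumulation point of it. This makes limits of
    difference quotients unique, including at the two endpoints. *)
Lemma within_dnbhs_proper t : t \in `[0, T] -> ProperFilter (within `[0, T] t^').
Proof.
rewrite in_itv /= => /andP[t0 tT]; split; last exact: within_filter.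
rewrite /within /= -/(dnbhs _ _) => /= -[e /= e0 he].
(* Step to the right when [t < T] and to the left otherwise; the minimum or maximum keeps [s] in the
   interval and [e / 2] keeps it in the ball. *)
have [lt|ge] := ltP t T.
  pose s := Num.min T (t + e / 2).
  have ts : t < s by rewrite lt_min lt ltrDl divr_gt0.
  have se : s <= t + e / 2 by rewrite ge_min lexx orbT.
  apply: (he s); rewrite /=.
  - by rewrite ltr_distl; apply/andP; split; lra.
  - by rewrite gt_eqF.
  - by rewrite in_itv /= (le_trans t0 (ltW ts)) /= ge_min lexx.
pose s := Num.max 0 (t - e / 2).
have ts : s < t by rewrite gt_max (lt_le_trans T_gt0 ge) /= ltrBlDr ltrDl divr_gt0.
have se : t - e / 2 <= s by rewrite le_max lexx orbT.
apply: (he s); rewrite /=.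
- by rewrite ltr_distl; apply/andP; split; lra.
- by rewrite lt_eqF.
- by rewrite in_itv /= le_max lexx /= (le_trans (ltW ts) tT).
Qed.

Lemma has_dt_dtE (f : R -> R^o) t df : t \in `[0, T] -> has_dt f t df -> dt T f t = df.
Proof.
by move=> /within_dnbhs_proper tT h; exact: (cvg_lim (@norm_hausdorff _ R^o) h).
Qed.

(** Uniform convergence of the quotients implies pointwise convergence, so [u' t] is the pointwise
    derivative. Consequently the time derivative lies in [V] and may serve as a test function. *)
Lemma C1_time_has_dt {X : choiceType} (V : set (X -> R)) u t :
  t \in `[0, T] -> C1_time T V u ->
  V (fun x => dt T (u ^~ x) t) /\
  forall x, has_dt (u ^~ x : R -> R^o) t (dt T (u ^~ x) t).
Proof.
move=> tT [_ [u' [Vu' _] /(_ t tT) uu']].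
have F : Filter (within `[0, T] t^') by exact: within_filter.
have hu x : has_dt (u ^~ x : R -> R^o) t (u' t x).
  have := uniform_subset_cvg _ (@subsetT _ [set x]) uu'.
  by rewrite uniform_set1; exact.
have E x : dt T (u ^~ x) t = u' t x by exact: has_dt_dtE.
split; last by move=> x; rewrite E.
by rewrite (_ : (fun x => _) = u' t); [exact: Vu'|apply/funext].
Qed.

End TimeDerivative.

(** * Elementwise gradients of finite element functions *)

Section FiniteElementFunctions.
Context {R : realType} {d : nat} {J : finType}.
Variables (l : R) (p : J -> 'I_d.+1 -> 'cV[R]_d).
Implicit Types v : 'cV[R]_d -> R.

Lemma dotE n (u w : 'cV[R]_n) : dot u w = \sum_i u i ord0 * w i ord0.
Proof. by rewrite /dot mxE; apply: eq_bigr => i _; rewrite mxE. Qed.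

Lemma affine_increment v (A : set 'cV[R]_d) b c x i (h : R) :
  (forall y, A y -> v y = dot b y + c) -> A x -> A (h *: delta_mx i ord0 + x) ->
  v (h *: delta_mx i ord0 + x) - v x = h * b i ord0.
Proof.
move=> vE Ax Ah; rewrite (vE _ Ah) (vE x)//.
rewrite /dot mulmxDr mxE opprD addrACA subrr addr0 addrK -scalemxAr mxE.
congr (_ * _); rewrite mxE (bigD1 i)//= big1 => [|k ki].
  by rewrite !mxE !eqxx mulr1 addr0.
by rewrite !mxE (negbTE ki) mulr0.
Qed.

Lemma near_interior_shift (A : set 'cV[R]_d) x (e : 'cV[R]_d) :
  A° x -> \forall h \near (0 : R)^', A (h *: e + x).
Proof.
move=> Ax.
suff : h *: e + x @[h --> (0 : R)^'] --> x by apply.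
rewrite -[X in _ --> X]add0r -[X in X + x](scale0r e).
apply: cvgD; last exact: cvg_cst.
by apply: cvgZ; [exact: (@nbhs_dnbhs _ (0 : R))|exact: cvg_cst].
Qed.

Lemma derive_affine_interior v (A : set 'cV[R]_d) b c x i :
  (forall y, A y -> v y = dot b y + c) -> A° x ->
  'D_(delta_mx i ord0) v x = b i ord0.
Proof.
move=> vE Ax; apply: (@cvg_lim R) => //.
(* For small steps the shifted point stays in [A], where the difference quotient of an affine
   function is constant. *)
apply: (@cvg_trans _ (cst (b i ord0) @ (0 : R)^')); last exact: cvg_cst.
apply: near_eq_cvg.
near=> h; have h0 : h != 0 by near: h; exact: nbhs_dnbhs_neq.
rewrite /= (affine_increment vE (interior_subset Ax)).
  by rewrite /GRing.scale /= mulKf.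
by near: h; exact: near_interior_shift.
Unshelve. all: by end_near. Qed.

(** [None] stands for the complement of all open elements, where [grad] is 0 by convention. The
    pieces form a finite Borel cover on each of which gradients of [Vh] functions are constant. *)
Definition piece (o : option J) : set 'cV[R]_d :=
  if o is Some j then (simplex (p j))° else ~` \bigcup_j (simplex (p j))°.

Lemma piece_cover x : exists o, piece o x.
Proof.
have [[j _ jx]|nx] := pselect ((\bigcup_j (simplex (p j))°) x); first by exists (Some j).
by exists None.
Qed.

Lemma borel_piece o : measurable (piece o : set (borel R d)).
Proof.
case: o => [j|] /=; first by apply: open_borel; exact: open_interior.
apply: measurableC; apply: open_borel; apply: bigcup_open => j _.
exact: open_interior.
Qed.

Lemma grad_piece v : Vh l p v ->
  exists b : option J -> 'cV[R]_d, forall o x, piece o x -> grad p v x = b o.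
Proof.
move=> [_ _ /choice[b /choice[c vE]]].
exists (fun o => if o is Some j then b j else 0) => -[j|] x /= xo; rewrite /grad.
  case: asboolP => [_|[]]; last by exists j.
  by apply/colP => i; rewrite mxE (derive_affine_interior _ (vE j)).
by case: asboolP => // -[j jx]; exfalso; apply: xo; exists j.
Qed.

(** The factor [k] and the point [y] do not depend on [v]: inside an element one fixed step computes
    the slope of every affine function exactly. A gradient component is thus a fixed linear
    combination of two point values, which is why it commutes with the time derivative. *)
Lemma grad_quotient x i : exists (k : R) y,
  forall v, Vh l p v -> grad p v x i ord0 = k * (v y - v x).
Proof.
have [[j jx]|nx] := pselect (exists j, (simplex (p j))° x); last first.
  (* Outside the open elements, [k = 0] reproduces the default value of [grad]. *)
  by exists 0, x => v _; rewrite /grad; case: asboolP => // _; rewrite mxE mul0r.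
have [h [h0 hx]] : exists h : R, h != 0 /\ simplex (p j) (h *: delta_mx i ord0 + x).
  near (0 : R)^' => h; exists h; split; near: h; first exact: nbhs_dnbhs_neq.
  exact: near_interior_shift.
exists h^-1, (h *: delta_mx i ord0 + x) => v [_ _ /(_ j) [b [c vE]]].
rewrite /grad; case: asboolP => [_|[]]; last by exists j.
rewrite mxE (derive_affine_interior _ vE jx).
by rewrite (affine_increment vE (interior_subset jx) hx) mulKf.
Unshelve. all: by end_near. Qed.

Lemma Vh1 : Vh l p (fun=> 1).
Proof.
split => // [x|j]; first exact: cst_continuous.
by exists 0, 1 => x _; rewrite /dot trmx0 mul0mx mxE add0r.
Qed.

Lemma grad_cst (c : R) x : grad p (fun=> c) x = 0.
Proof.
by rewrite /grad; case: ifP => // _; apply/colP => i; rewrite !mxE derive_cst.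
Qed.

Lemma tame_Vh a v : Vh l p v -> tame a l v.
Proof. by move=> [_ cv _]; apply: tame_continuous => x _; exact: cv. Qed.

Lemma tame_grad a v i : Vh l p v -> tame a l (fun x => grad p v x i ord0).
Proof.
move=> /grad_piece[b bE].
apply: (@tame_pieces _ _ _ _ _ piece (fun o _ => b o i ord0)) => [?|x _|?|o x _ /bE ->//].
- exact: borel_piece.
- exact: piece_cover.
- exact: tame_cst.
Qed.

(** With both gradients constant on a piece, the state there agrees with a continuous function of
    [x]; positivity of [theta] on the cube keeps it in the set where [h] is continuous. *)
Lemma tame_state a rho theta eta (h : state R d -> R) :
  {in admissible, continuous h} ->
  Vh l p rho -> Vhpos a l p theta -> Vh l p eta ->
  tame a l (fun x => h (fields_state p rho theta eta x)).
Proof.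
move=> ch Vrho [Vtheta theta_gt0] Veta.
have [b bE] := grad_piece Vrho; have [b' b'E] := grad_piece Veta.
pose g o x := h (rho x, b o, theta x, eta x, b' o).
apply: (@tame_pieces _ _ _ _ _ piece g) => [?|x _|w|w x _ xw].
- exact: borel_piece.
- exact: piece_cover.
- apply: tame_continuous => x xa.
  apply: (@continuous_comp _ _ _ (fun y => (rho y, b w, theta y, eta y, b' w) : state R d) h).
    have cV v : Vh l p v -> {for x, continuous v} by move=> [_ + _]; exact.
    have := cV _ Vrho; have := cV _ Vtheta; have := cV _ Veta => ceta ctheta crho.
    exact: (cvg_pair (cvg_pair (cvg_pair
      (cvg_pair crho (cvg_cst _)) ctheta) ceta) (cvg_cst _)).
  by apply: ch; rewrite inE /admissible /=; exact: theta_gt0.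
by rewrite /g /fields_state (bE w)// (b'E w).
Qed.

End FiniteElementFunctions.

Lemma has_dt_grad (R : realType) (d : nat) (J : finType) (l T : R)
    (p : J -> 'I_d.+1 -> 'cV[R]_d) (u : R -> 'cV[R]_d -> R) t x i :
  0 < T -> t \in `[0, T] -> C1_time T (Vh l p) u ->
  has_dt T (fun s => grad p (u s) x i ord0 : R^o) t
    (grad p (fun y => dt T (u ^~ y) t) x i ord0).
Proof.
move=> T0 tT Cu; have [Vdu du] := C1_time_has_dt T0 tT Cu.
have [k [y kE]] := grad_quotient l p x i; rewrite kE//.
apply: (@eq_has_dt _ _ _ (fun s => k *: (u s y - u s x) : R^o)) => // [s sT|].
  by rewrite kE//; apply: Cu.1.1.
by apply: has_dtZ; exact: has_dtB.
Qed.

(** * Chain rule and tameness for the potential *)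

(** Both sides are limits of the same quotient. This turns the partial derivatives of [psi] into
    directional derivatives, the form in which its smoothness is stated. *)
Lemma derive1_line (R : realType) (V : normedModType R) (F : V -> R^o) (f : R -> R)
    (z v : V) (x : R) :
  (forall h : R, f (h + x) = F (h *: v + z)) -> derive1 f x = 'D_v F z.
Proof.
move=> fF.
have E : (fun h : R => h^-1 * (f (h + x) - f x)) =
    (fun h => h^-1 *: ((F \o shift z) (h *: v) - F z)).
  by apply/funext => h; rewrite -{2}(add0r x) !fF scale0r add0r.
exact: (congr1 (fun g : R -> R => lim (g @ (0 : R)^')) E).
Qed.

Section SmoothPotential.
Context {R : realType}.
Variable psi : R -> R -> R -> R.
Hypothesis psi_sm : psi_smooth psi.

Let P := (R^o * R^o * R^o)%type.
Let Psi (z : P) : R^o := psi z.1.1 z.1.2 z.2.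
Let dom : set P := [set z | 0 < z.1.2].
Let e1 : P := (1, 0, 0).
Let e2 : P := (0, 1, 0).
Let e3 : P := (0, 0, 1).

Lemma psi_rhoE r th e : psi_rho psi r th e = 'D_e1 Psi (r, th, e).
Proof.
apply: derive1_line => h; rewrite /Psi /= /GRing.scale /=.
by rewrite mulr1 mulr0 !add0r.
Qed.

Lemma energyE r th e : energy psi r th e = 'D_e2 Psi (r, th, e).
Proof.
apply: derive1_line => h; rewrite /Psi /= /GRing.scale /=.
by rewrite mulr1 mulr0 !add0r.
Qed.

Lemma psi_etaE r th e : psi_eta psi r th e = 'D_e3 Psi (r, th, e).
Proof.
apply: derive1_line => h; rewrite /Psi /= /GRing.scale /=.
by rewrite mulr1 mulr0 !add0r.
Qed.

Lemma derive_coordinates (F : P -> R^o) z (dz : P) : differentiable F z ->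
  'D_dz F z = dz.1.1 * 'D_e1 F z + dz.1.2 * 'D_e2 F z + dz.2 * 'D_e3 F z.
Proof.
move=> dF; rewrite !deriveE//.
have {1}-> : dz = dz.1.1 *: e1 + dz.1.2 *: e2 + dz.2 *: e3.
  case: dz => -[x y] w; congr (_, _, _) => /=;
  by rewrite /GRing.scale /= !(mulr0, mulr1, addr0, add0r).
by rewrite !linearD !linearZ.
Qed.

Lemma differentiable_psi z : dom z -> differentiable Psi z.
Proof. by case: (psi_sm 1) => + _; apply. Qed.

Lemma differentiable_D_psi v z : dom z -> differentiable ('D_v Psi : P -> R^o) z.
Proof. by case: (psi_sm 2) => _ /(_ v)[+ _]; apply. Qed.

Section Curve.
Variables (T t : R) (rho theta eta : R -> R^o) (drho dtheta deta : R^o).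
Hypothesis theta_gt0 : 0 < theta t.
Hypothesis rho_dt : has_dt T rho t drho.
Hypothesis theta_dt : has_dt T theta t dtheta.
Hypothesis eta_dt : has_dt T eta t deta.

Lemma has_dt_psi : has_dt T (fun s => psi (rho s) (theta s) (eta s) : R^o) t
  (psi_rho psi (rho t) (theta t) (eta t) * drho
   + energy psi (rho t) (theta t) (eta t) * dtheta
   + psi_eta psi (rho t) (theta t) (eta t) * deta).
Proof.
have z_dt := has_dt_pair (has_dt_pair rho_dt theta_dt) eta_dt.
have dPsi := @differentiable_psi (rho t, theta t, eta t) theta_gt0.
have := has_dt_comp dPsi z_dt.
rewrite derive_coordinates//= psi_rhoE energyE psi_etaE.
by rewrite (mulrC drho) (mulrC dtheta) (mulrC deta).
Qed.

(** The explicit value serves two purposes: it shows that the time derivative of the energy exists,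
    and it exhibits it as a sum of products of tame functions. *)
Lemma has_dt_energy :
  has_dt T (fun s => energy psi (rho s) (theta s) (eta s) : R^o) t
  (drho * 'D_e1 ('D_e2 Psi) (rho t, theta t, eta t)
   + dtheta * 'D_e2 ('D_e2 Psi) (rho t, theta t, eta t)
   + deta * 'D_e3 ('D_e2 Psi) (rho t, theta t, eta t)).
Proof.
under eq_fun do rewrite energyE.
have z_dt := has_dt_pair (has_dt_pair rho_dt theta_dt) eta_dt.
have dPsi := @differentiable_D_psi e2 (rho t, theta t, eta t) theta_gt0.
by have := has_dt_comp dPsi z_dt; rewrite derive_coordinates.
Qed.

End Curve.

Section TamePotential.
Context {d : nat} {J : finType}.
Variables (a : 'cV[R]_d) (l : R) (p : J -> 'I_d.+1 -> 'cV[R]_d).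
Variables rho theta eta : 'cV[R]_d -> R.
Hypothesis rho_Vh : Vh l p rho.
Hypothesis theta_Vhpos : Vhpos a l p theta.
Hypothesis eta_Vh : Vh l p eta.

Lemma tame_potential (F : P -> R) : {in dom, continuous F} ->
  tame a l (fun x => F (rho x, theta x, eta x)).
Proof.
move=> cF; apply: tame_continuous => x xa.
apply: (@continuous_comp _ _ _ (fun y => (rho y, theta y, eta y) : P) F).
  have cV v : Vh l p v -> {for x, continuous v} by move=> [_ + _]; exact.
  exact: (cvg_pair (cvg_pair (cV _ rho_Vh) (cV _ theta_Vhpos.1)) (cV _ eta_Vh)).
by apply: cF; rewrite inE; exact: theta_Vhpos.2.
Qed.

Lemma tame_psi_rho : tame a l (fun x => psi_rho psi (rho x) (theta x) (eta x)).
Proof.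
under eq_fun do rewrite psi_rhoE.
by apply: (@tame_potential ('D_e1 Psi)); case: (psi_sm 1) => _ /(_ e1).
Qed.

Lemma tame_psi_eta : tame a l (fun x => psi_eta psi (rho x) (theta x) (eta x)).
Proof.
under eq_fun do rewrite psi_etaE.
by apply: (@tame_potential ('D_e3 Psi)); case: (psi_sm 1) => _ /(_ e3).
Qed.

Lemma tame_D_energy v :
  tame a l (fun x => 'D_v ('D_e2 Psi) (rho x, theta x, eta x)).
Proof.
by apply: (@tame_potential ('D_v ('D_e2 Psi))); case: (psi_sm 2) => _ /(_ e2)[_ /(_ v)].
Qed.

End TamePotential.

End SmoothPotential.

(** * The mobility form and tameness of the fluxes *)

Section Flux.
Context {R : realType}.

Lemma dotNl n (u w : 'cV[R]_n) : dot (- u) w = - dot u w.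
Proof. by rewrite /dot linearN mulNmx mxE. Qed.

Lemma dotC n (u w : 'cV[R]_n) : dot u w = dot w u.
Proof. by rewrite !dotE; apply: eq_bigr => i _; rewrite mulrC. Qed.

Lemma dot_col_mx m n (u u' : 'cV[R]_m) (w w' : 'cV[R]_n) :
  dot (col_mx u w) (col_mx u' w') = dot u u' + dot w w'.
Proof. by rewrite /dot tr_col_mx mul_row_col mxE. Qed.

(** The block rows of the matrix applied to [F] are the flux of the mass equation, minus the flux of
    the energy equation, and the reaction term of the equation for [eta]; this accounts for the
    middle sign. *)
Lemma mobility_form d (L : mobility R d) z (A B : 'cV[R]_d) (c : R) :
  let F := col_mx (col_mx A B) c%:M in
  dot F (mobility_matrix L z *m F) =
    dot (L11 L z *m A - L12 L z *m B + c *: L13 L z) A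
    - dot (L12 L z *m A - L22 L z *m B + c *: L23 L z) B
    + (dot (L13 L z) A - dot (L23 L z) B + L33 L z * c) * c.
Proof.
rewrite /= /mobility_matrix !mul_block_col mul_col_mx mul_row_col.
rewrite !add_col_mx !dot_col_mx !mulNmx !mul_mx_scalar.
rewrite !(dotC A) !(dotC B) -dotNl; congr (_ + _ + _).
  by congr dot; rewrite !opprD opprK.
rewrite [LHS]dotE big_ord1 mulrC [c%:M _ _]mxE eqxx mulr1n; congr (_ * _).
by rewrite /dot !mxE eqxx mulr1n (mulrC c).
Qed.

End Flux.

Section TameFlux.
Context {R : realType} {d : nat}.
Variables (a : 'cV[R]_d) (l : R).

Lemma tame_dot n (u w : 'cV[R]_d -> 'cV[R]_n) :
  (forall i, tame a l (fun x => u x i ord0)) ->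
  (forall i, tame a l (fun x => w x i ord0)) ->
  tame a l (fun x => dot (u x) (w x)).
Proof.
move=> tu tw; under eq_fun do rewrite dotE.
by apply: tame_sum => i; exact: tameM.
Qed.

Lemma tame_mulmx m n (M : 'cV[R]_d -> 'M[R]_(m, n)) (w : 'cV[R]_d -> 'cV[R]_n) i :
  (forall i j, tame a l (fun x => M x i j)) ->
  (forall i, tame a l (fun x => w x i ord0)) ->
  tame a l (fun x => (M x *m w x) i ord0).
Proof.
move=> tM tw; under eq_fun do rewrite mxE.
by apply: tame_sum => j; exact: tameM.
Qed.

Lemma tame_flux n (M N : 'cV[R]_d -> 'M[R]_n) (u w q : 'cV[R]_d -> 'cV[R]_n)
    (c : 'cV[R]_d -> R) i :
  (forall i j, tame a l (fun x => M x i j)) ->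
  (forall i j, tame a l (fun x => N x i j)) ->
  (forall i, tame a l (fun x => u x i ord0)) ->
  (forall i, tame a l (fun x => w x i ord0)) ->
  (forall i, tame a l (fun x => q x i ord0)) -> tame a l c ->
  tame a l (fun x => (M x *m u x - N x *m w x + c x *: q x) i ord0).
Proof.
move=> tM tN tu tw tq tc.
have E x : (M x *m u x - N x *m w x + c x *: q x) i ord0 =
    (M x *m u x) i ord0 - (N x *m w x) i ord0 + c x * q x i ord0.
  by rewrite !mxE.
under eq_fun do rewrite E.
by apply: tameD; [apply: tameD; [|apply: tameN]; exact: tame_mulmx|exact: tameM].
Qed.

Context {J : finType}.
Variables (p : J -> 'I_d.+1 -> 'cV[R]_d) (L : mobility R d).
Variables rho theta eta : 'cV[R]_d -> R.
Hypothesis L_C1 : mobility_C1_bounded L.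
Hypothesis rho_Vh : Vh l p rho.
Hypothesis theta_Vhpos : Vhpos a l p theta.
Hypothesis eta_Vh : Vh l p eta.
Let z := fields_state p rho theta eta.

(** Regularity is assumed for the assembled matrix. The blocks are then recovered as its entries,
    undoing the sign for [L12] and [L23]. *)
Lemma tame_mobility_matrix i j : tame a l (fun x => mobility_matrix L (z x) i j).
Proof.
apply: (@tame_state _ _ _ l p a rho theta eta (fun y => mobility_matrix L y i j)) => //.
have [M /(_ i j)[[dL _] _]] := L_C1.
by move=> y; rewrite inE => /dL /differentiable_continuous.
Qed.

Lemma tame_L11 i j : tame a l (fun x => L11 L (z x) i j).
Proof.
have := tame_mobility_matrix (lshift 1 (lshift d i)) (lshift 1 (lshift d j)).
by under eq_fun do rewrite !block_mxEul.
Qed.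

Lemma tame_L12 i j : tame a l (fun x => L12 L (z x) i j).
Proof.
have := tameN (tame_mobility_matrix (lshift 1 (lshift d i)) (lshift 1 (rshift d j))).
by under eq_fun do rewrite block_mxEul block_mxEur mxE opprK.
Qed.

Lemma tame_L22 i j : tame a l (fun x => L22 L (z x) i j).
Proof.
have := tame_mobility_matrix (lshift 1 (rshift d i)) (lshift 1 (rshift d j)).
by under eq_fun do rewrite block_mxEul block_mxEdr.
Qed.

Lemma tame_L13 i : tame a l (fun x => L13 L (z x) i ord0).
Proof.
have := tame_mobility_matrix (lshift 1 (lshift d i)) (rshift (d + d) ord0).
by under eq_fun do rewrite block_mxEur col_mxEu.
Qed.

Lemma tame_L23 i : tame a l (fun x => L23 L (z x) i ord0).
Proof.
have := tameN (tame_mobility_matrix (lshift 1 (rshift d i)) (rshift (d + d) ord0)).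
by under eq_fun do rewrite block_mxEur col_mxEd mxE opprK.
Qed.

Lemma tame_L33 : tame a l (fun x => L33 L (z x)).
Proof.
have := tame_mobility_matrix (rshift (d + d) ord0) (rshift (d + d) ord0).
by under eq_fun do rewrite block_mxEdr mxE eqxx mulr1n.
Qed.

End TameFlux.

(** * Entropy rate and dissipation in terms of the tested equations *)

(** The product rule for [theta] times the energy yields the energy times the derivative of [theta].
    Because the energy is the [theta]-derivative of [psi], the chain rule for [psi] yields the same
    term and the two cancel. *)
Lemma has_dt_entropy (R : realType) (d : nat) (J : finType) (l T : R)
    (p : J -> 'I_d.+1 -> 'cV[R]_d) (gamma_rho gamma_eta : R)
    (psi : R -> R -> R -> R) (rho theta eta : R -> 'cV[R]_d -> R) (t : R) x :
  psi_smooth psi -> 0 < T -> t \in `[0, T] -> 0 < theta t x ->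
  C1_time T (Vh l p) rho -> C1_time T (Vh l p) theta -> C1_time T (Vh l p) eta ->
  has_dt T (fun s => entropy p psi gamma_rho gamma_eta (rho s) (theta s) (eta s) x
    : R^o) t
    (theta t x * dt T (fun s => energy psi (rho s x) (theta s x) (eta s x)) t
     - psi_rho psi (rho t x) (theta t x) (eta t x) * dt T (rho ^~ x) t
     - psi_eta psi (rho t x) (theta t x) (eta t x) * dt T (eta ^~ x) t
     - gamma_rho * dot (grad p (rho t) x) (grad p (fun y => dt T (rho ^~ y) t) x)
     - gamma_eta * dot (grad p (eta t) x) (grad p (fun y => dt T (eta ^~ y) t) x)).
Proof.
move=> psi_sm T0 tT theta0 Crho Ctheta Ceta.
have [_ /(_ x) rho_dt] := C1_time_has_dt T0 tT Crho.
have [_ /(_ x) theta_dt] := C1_time_has_dt T0 tT Ctheta.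
have [_ /(_ x) eta_dt] := C1_time_has_dt T0 tT Ceta.
have psi_dt := has_dt_psi psi_sm theta0 rho_dt theta_dt eta_dt.
have energy_dt := has_dt_energy psi_sm theta0 rho_dt theta_dt eta_dt.
(* The second derivatives of [psi] are folded back into [dt] of the energy, the quantity occurring
   in the scheme. *)
move: (energy_dt); rewrite -(has_dt_dtE T0 tT energy_dt) => {}energy_dt.
have dot_dt u : C1_time T (Vh l p) u ->
    has_dt T (fun s => dot (grad p (u s) x) (grad p (u s) x) : R^o) t
      (2 * dot (grad p (u t) x) (grad p (fun y => dt T (u ^~ y) t) x) : R^o).
  move=> Cu; under eq_fun do rewrite dotE.
  rewrite dotE mulr_sumr; apply: has_dt_sum => i.
  have := has_dt_grad T0 tT Cu (x := x) (i := i) => h; have := has_dtM h h.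
  by congr has_dt; ring.
have := has_dtB (has_dtB (has_dtB (has_dtM theta_dt energy_dt) psi_dt)
  (has_dtZ (c := gamma_rho / 2) (dot_dt _ Crho)))
  (has_dtZ (c := gamma_eta / 2) (dot_dt _ Ceta)).
by congr has_dt; rewrite /GRing.scale /=; field.
Qed.

Lemma tame_dt_energy (R : realType) (d : nat) (J : finType) (a : 'cV[R]_d) (l T : R)
    (p : J -> 'I_d.+1 -> 'cV[R]_d) (psi : R -> R -> R -> R)
    (rho theta eta : R -> 'cV[R]_d -> R) (t : R) :
  psi_smooth psi -> 0 < T -> t \in `[0, T] -> Vhpos a l p (theta t) ->
  C1_time T (Vh l p) rho -> C1_time T (Vh l p) theta -> C1_time T (Vh l p) eta ->
  tame a l (fun x => dt T (fun s => energy psi (rho s x) (theta s x) (eta s x)) t).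
Proof.
move=> psi_sm T0 tT theta_Vhpos Crho Ctheta Ceta.
have [Vdrho rho_dt] := C1_time_has_dt T0 tT Crho.
have [Vdtheta theta_dt] := C1_time_has_dt T0 tT Ctheta.
have [Vdeta eta_dt] := C1_time_has_dt T0 tT Ceta.
have rho_Vh := Crho.1.1 t tT; have eta_Vh := Ceta.1.1 t tT.
have tame_D := tame_D_energy psi_sm rho_Vh theta_Vhpos eta_Vh.
have energy_dt x (xa : cube a l x) :=
  has_dt_energy psi_sm (theta_Vhpos.2 x xa) (rho_dt x) (theta_dt x) (eta_dt x).
apply: (tame_eq (fun x xa => esym (has_dt_dtE T0 tT (energy_dt x xa)))).
have tame_d v e : Vh l p v -> tame a l (fun x => v x *
    'D_e ('D_(0, 1, 0) (fun z : R^o * R^o * R^o => psi z.1.1 z.1.2 z.2 : R^o))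
      (rho t x, theta t x, eta t x)).
  by move=> /tame_Vh tv; exact: tameM (tv a) (tame_D e).
exact: tameD (tameD (tame_d _ _ Vdrho) (tame_d _ _ Vdtheta)) (tame_d _ _ Vdeta).
Qed.

(** This is [mobility_form] integrated over the cube; each of the three terms is tame, so the
    integral splits. *)
Lemma dissipation_fluxE (R : realType) (d : nat) (J : finType) (a : 'cV[R]_d) (l : R)
    (p : J -> 'I_d.+1 -> 'cV[R]_d) (L : mobility R d)
    (rho theta eta mu_rho mu_eta : 'cV[R]_d -> R) :
  d = 2%N \/ d = 3%N -> mobility_C1_bounded L ->
  Vh l p rho -> Vhpos a l p theta -> Vh l p eta -> Vh l p mu_rho -> Vh l p mu_eta ->
  let z := fields_state p rho theta eta in
  let Dmu := grad p mu_rho in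
  let Dtheta := grad p theta in
  dissipation p a l (fun x => mobility_matrix L (z x)) mu_rho theta mu_eta =
    vinner a l (fun x => L11 L (z x) *m Dmu x - L12 L (z x) *m Dtheta x
                         + mu_eta x *: L13 L (z x)) Dmu
    - vinner a l (fun x => L12 L (z x) *m Dmu x - L22 L (z x) *m Dtheta x
                           + mu_eta x *: L23 L (z x)) Dtheta
    + inner a l (fun x => dot (L13 L (z x)) (Dmu x) - dot (L23 L (z x)) (Dtheta x)
                          + L33 L (z x) * mu_eta x) mu_eta.
Proof.
move=> d23 L_C1 Vrho Vtheta Veta Vmu_rho Vmu_eta z Dmu Dtheta.
have tM11 := tame_L11 L_C1 Vrho Vtheta Veta.
have tM12 := tame_L12 L_C1 Vrho Vtheta Veta.
have tM22 := tame_L22 L_C1 Vrho Vtheta Veta.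
have tM13 := tame_L13 L_C1 Vrho Vtheta Veta.
have tM23 := tame_L23 L_C1 Vrho Vtheta Veta.
have tM33 := tame_L33 L_C1 Vrho Vtheta Veta.
have tDmu i := tame_grad a i Vmu_rho; have tDtheta i := tame_grad a i Vtheta.1.
have tmu := tame_Vh a Vmu_eta.
have f1 := tame_dot (fun i => tame_flux i tM11 tM12 tDmu tDtheta tM13 tmu) tDmu.
have f2 := tame_dot (fun i => tame_flux i tM12 tM22 tDmu tDtheta tM23 tmu) tDtheta.
have f3 := tameM (tameD (tameB (tame_dot tM13 tDmu) (tame_dot tM23 tDtheta))
  (tameM tM33 tmu)) tmu.
rewrite /inner /vinner -(cube_integralB d23 f1 f2) -(cube_integralD d23 (tameB f1 f2) f3).
by apply: eq_cube_integral => // x _; exact: mobility_form.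
Qed.

Lemma entropy_rateE (R : realType) (d : nat) (J : finType) (a : 'cV[R]_d) (l T : R)
    (p : J -> 'I_d.+1 -> 'cV[R]_d) (gamma_rho gamma_eta : R)
    (psi : R -> R -> R -> R) (rho theta eta : R -> 'cV[R]_d -> R) (t : R) :
  d = 2%N \/ d = 3%N ->
  psi_smooth psi -> 0 < T -> t \in `[0, T] -> Vhpos a l p (theta t) ->
  C1_time T (Vh l p) rho -> C1_time T (Vh l p) theta -> C1_time T (Vh l p) eta ->
  let drho x := dt T (rho ^~ x) t in
  let deta x := dt T (eta ^~ x) t in
  inner a l (fun x => dt T (fun s => entropy p psi gamma_rho gamma_eta
                                       (rho s) (theta s) (eta s) x) t) (fun=> 1) =
    inner a l (fun x => dt T (fun s => energy psi (rho s x) (theta s x) (eta s x)) t)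
      (theta t)
    - inner a l (fun x => psi_rho psi (rho t x) (theta t x) (eta t x)) drho
    - inner a l (fun x => psi_eta psi (rho t x) (theta t x) (eta t x)) deta
    - gamma_rho * vinner a l (grad p (rho t)) (grad p drho)
    - gamma_eta * vinner a l (grad p (eta t)) (grad p deta).
Proof.
move=> d23 psi_sm T_gt0 tT theta_Vhpos rho_C1 theta_C1 eta_C1 drho deta.
have [Vdrho _] := C1_time_has_dt T_gt0 tT rho_C1.
have [Vdeta _] := C1_time_has_dt T_gt0 tT eta_C1.
have Vrho := rho_C1.1.1 t tT; have Veta := eta_C1.1.1 t tT.
have t1 := tameM (tame_dt_energy psi_sm T_gt0 tT theta_Vhpos rho_C1 theta_C1 eta_C1)
  (tame_Vh a theta_Vhpos.1).
have t2 := tameM (tame_psi_rho psi_sm Vrho theta_Vhpos Veta) (tame_Vh a Vdrho).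
have t3 := tameM (tame_psi_eta psi_sm Vrho theta_Vhpos Veta) (tame_Vh a Vdeta).
have t4 := tame_dot (fun i => tame_grad a i Vrho) (fun i => tame_grad a i Vdrho).
have t5 := tame_dot (fun i => tame_grad a i Veta) (fun i => tame_grad a i Vdeta).
have integral_split f1 f2 f3 f4 f5 :
    tame a l f1 -> tame a l f2 -> tame a l f3 -> tame a l f4 -> tame a l f5 ->
    cube_integral a l
      (fun x => f1 x - f2 x - f3 x - gamma_rho * f4 x - gamma_eta * f5 x) =
    cube_integral a l f1 - cube_integral a l f2 - cube_integral a l f3
    - gamma_rho * cube_integral a l f4 - gamma_eta * cube_integral a l f5.
  move=> u1 u2 u3 u4 u5.
  have u4' := tameM (tame_cst a l gamma_rho) u4.
  have u5' := tameM (tame_cst a l gamma_eta) u5.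
  by rewrite !cube_integralB// ?cube_integralZ//; do ?apply: tameB.
apply: etrans (integral_split _ _ _ _ _ t1 t2 t3 t4 t5).
apply: eq_cube_integral => // x xa; rewrite mulr1.
have := has_dt_entropy (gamma_rho := gamma_rho) (gamma_eta := gamma_eta) psi_sm T_gt0 tT
  (theta_Vhpos.2 x xa) rho_C1 theta_C1 eta_C1.
by move=> /(has_dt_dtE T_gt0 tT) ->; rewrite [theta t x * _]mulrC.
Qed.

Theorem lemma4 (R : realType) (d : nat) (d23 : d = 2%N \/ d = 3%N)
    (a : 'cV[R]_d) (l : R) (l_gt0 : 0 < l)
    (J : finType) (p : J -> 'I_d.+1 -> 'cV[R]_d) (mesh : periodic_mesh a l p)
    (gamma_rho gamma_eta : R) (gamma_rho_gt0 : 0 < gamma_rho)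
    (gamma_eta_gt0 : 0 < gamma_eta)
    (L : mobility R d) (lam0 lam1 : R) (lam0_gt0 : 0 < lam0) (lam1_gt0 : 0 < lam1)
    (L_elliptic : mobility_elliptic L lam0 lam1) (L_C1 : mobility_C1_bounded L)
    (psi psi_vex psi_cav : R -> R -> R -> R)
    (psi_sm : psi_smooth psi) (psi_temp : psi_temperature psi)
    (psi_split : psi_splitting psi psi_vex psi_cav)
    (T : R) (T_gt0 : 0 < T)
    (rho theta eta mu_rho mu_eta : R -> 'cV[R]_d -> R)
    (rho_C1 : C1_time T (Vh l p) rho)
    (theta_C1 : C1_time T (Vh l p) theta)
    (theta_pos : forall t, t \in `[0, T] -> Vhpos a l p (theta t))
    (eta_C1 : C1_time T (Vh l p) eta)
    (mu_rho_C0 : C0_time T (Vh l p) mu_rho)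
    (mu_eta_C0 : C0_time T (Vh l p) mu_eta)
    (rho0 theta0 eta0 : 'cV[R]_d -> R)
    (rho0_Vh : Vh l p rho0) (theta0_Vh : Vhpos a l p theta0)
    (eta0_Vh : Vh l p eta0)
    (initial : [/\ rho 0 = rho0, theta 0 = theta0 & eta 0 = eta0])
    (solution : forall t, t \in `[0, T] ->
       semidiscrete_at a l p gamma_rho gamma_eta L psi T
         rho theta eta mu_rho mu_eta t) :
  forall t, t \in `[0, T] ->
  [/\ inner a l (fun x => dt T (rho ^~ x) t) (fun=> 1) = 0,
      inner a l
        (fun x => dt T (fun s => energy psi (rho s x) (theta s x) (eta s x)) t)
        (fun=> 1) = 0
    & inner a l
        (fun x => dt T (fun s => entropy p psi gamma_rho gamma_eta
                                   (rho s) (theta s) (eta s) x) t)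
        (fun=> 1)
      = dissipation p a l
          (fun x => mobility_matrix L
                      (fields_state p (rho t) (theta t) (eta t) x))
          (mu_rho t) (theta t) (mu_eta t)].

Proof.
move=> t tT; have theta_Vhpos := theta_pos t tT.
have [Vdrho _] := C1_time_has_dt T_gt0 tT rho_C1.
have [Vdeta _] := C1_time_has_dt T_gt0 tT eta_C1.
have mu_rho_Vh := mu_rho_C0.1 t tT; have mu_eta_Vh := mu_eta_C0.1 t tT.
(* Constants have zero gradient. Writing the zero integrand as [0 * 1] lets homogeneity of the
   integral give 0, whatever [F] is. *)
have vinner_grad1 F : vinner a l F (grad p (fun=> 1)) = 0.
  rewrite /vinner (@eq_cube_integral _ _ a l d23 _ (fun=> 0 * 1)) => [|x _].
    by rewrite cube_integralZ ?mul0r//; exact: tame_cst.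
  by rewrite grad_cst dotC /dot trmx0 mul0mx mxE mul0r.
have innerC f g : inner a l f g = inner a l g f.
  by apply: eq_cube_integral => // x _; rewrite mulrC.
have V1 := Vh1 l p.
have [mass _ energy_conservation _ _] := solution t tT _ _ _ _ _ V1 V1 V1 V1 V1.
rewrite vinner_grad1 addr0 in mass.
rewrite vinner_grad1 addr0 in energy_conservation.
split; [exact: mass|exact: energy_conservation|].
(* The two time derivatives are admissible test functions by [C1_time_has_dt]. *)
have [eq_rho eq_mu_rho eq_theta eq_eta eq_mu_eta] := solution t tT _ _ _ _ _
  mu_rho_Vh Vdrho theta_Vhpos.1 mu_eta_Vh Vdeta.
rewrite (innerC (mu_rho t)) in eq_mu_rho; rewrite (innerC (mu_eta t)) in eq_mu_eta.
rewrite (entropy_rateE _ _ d23 psi_sm T_gt0 tT theta_Vhpos rho_C1 theta_C1 eta_C1).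
rewrite (dissipation_fluxE d23 L_C1 (rho_C1.1.1 t tT) theta_Vhpos (eta_C1.1.1 t tT)
  mu_rho_Vh mu_eta_Vh).
(* [Mr] and [Me] pair [mu_rho] and [mu_eta] with the time derivatives of [rho] and [eta]. Each
   occurs in two equations, once the order of the factors is matched, and eliminating them leaves
   the balance. *)
have balance (F1 F2 F3 De Mr Me Pr Pe Gr Ge : R) :
    Mr + F1 = 0 -> Mr - gamma_rho * Gr - Pr = 0 -> De + F2 = 0 ->
    Me + F3 = 0 -> Me - gamma_eta * Ge - Pe = 0 ->
    De - Pr - Pe - gamma_rho * Gr - gamma_eta * Ge = F1 - F2 + F3.
  by clear -gamma_rho gamma_eta => *; lra.
exact: balance eq_rho eq_mu_rho eq_theta eq_eta eq_mu_eta.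
Qed.
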